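(* For a finite set $S\subseteq\mathbb{R}^m$ let $g(S)$ be the dimension of the linear span of $S$ (the linear matroid rank). Then no test score achieves a constant-factor approximation: for every $c>0$ there exists a positive integer $k$ such that for every $m\ge k$ and every function $f:\mathbb{R}^m\to[0,\infty)$ there exist a finite set $S\subseteq\mathbb{R}^m$ with $|S|\ge k$ and a $k$-element subset $T'\subseteq S$ with $f(x)\ge f(y)$ for all $x\in T'$, $y\in S\setminus T'$, such that $g(T')<c\cdot\max_{T\subseteq S,|T|=k} g(T)$. *)

(* Defs.v *)
From mathcomp Require Export all_boot all_order all_algebra.
From mathcomp Require Export finmap reals.

Set Implicit Arguments.
Unset Strict Implicit.
Unset Printing Implicit Defensive.

Import Order.TTheory GRing.Theory Num.Theory.

Local Open Scope ring_scope.
Local Open Scope fset_scope.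

Definition linrank (R : realType) (m : nat) (S : {fset 'rV[R]_m}) : nat :=
  \dim <<enum_fset S>>%VS.

(* The maximum of an empty family is 0; the family is nonempty as soon as
   k <= #|` S|. *)
Definition max_linrank (R : realType) (m k : nat) (S : {fset 'rV[R]_m}) : nat :=
  (\max_(T <- fpowerset S | #|` T| == k) linrank T)%N.

(* Main.v *)
Require Import Defs.

Set Implicit Arguments.
Unset Strict Implicit.
Unset Printing Implicit Defensive.

Import Order.TTheory GRing.Theory Num.Theory.

Local Open Scope ring_scope.
Local Open Scope fset_scope.

(** Take [k > 1/c] independent lines and [k] nonzero vectors on each. On each
    line keep a vector of lowest score, and let [L] be the line whose lowest
    score is highest. The [k] vectors on [L] then dominate the kept vectors of
    all lines, so they form a legitimate top-[k] choice of rank 1, whereas the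
    kept vectors have rank [k]. *)

Lemma linrank_le1 (R : realType) (m : nat) (e : 'rV[R]_m)
    (S : {fset 'rV[R]_m}) :
  (forall x, x \in S -> x \in <[e]>%VS) -> (linrank S <= 1)%N.
Proof.
move=> Se; rewrite /linrank.
apply: (@leq_trans (\dim <[e]>%VS)); last by rewrite dim_vline leq_b1.
by apply/dimvS/span_subvP => x; apply: Se.
Qed.

Lemma linrank_free (R : realType) (m : nat) (S : {fset 'rV[R]_m})
    (s : seq 'rV[R]_m) :
  S =i s -> free s -> linrank S = size s.
Proof. by move=> Ss /eqP <-; rewrite /linrank (eq_span Ss). Qed.

Lemma linrank_le_max (R : realType) (m k : nat) (S T : {fset 'rV[R]_m}) :
  T `<=` S -> #|` T| = k -> (linrank T <= max_linrank k S)%N.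
Proof.
move=> TS Tk; rewrite /max_linrank.
by apply: (@leq_bigmax_seq _ _ _ (@linrank R m)); rewrite ?fpowersetE ?Tk.
Qed.

(** In a vanishing combination, coordinate [h i] sees only the term of index [i], since [h] is
    injective; it reads [b i * a i = 0]. *)
Lemma free_scaled_basis (R : realType) (m k : nat) (h : 'I_k -> 'I_m)
    (a : 'I_k -> R) :
  injective h -> (forall i, a i != 0) ->
  free [tuple a i *: delta_mx 0 (h i) : 'rV[R]_m | i < k].
Proof.
move=> hI a0; apply/freeP => b b0 i; move/rowP/(_ (h i)): b0.
rewrite summxE (bigD1 i) // big1 => [|j ji].
  rewrite -tnth_nth tnth_mktuple !mxE !eqxx /= mulr1 addr0 => /eqP.
  by rewrite mulf_eq0 (negPf (a0 i)) orbF => /eqP.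
by rewrite -tnth_nth tnth_mktuple !mxE (inj_eq hI) eq_sym (negPf ji) !mulr0.
Qed.

Theorem theorem3p7 (R : realType) (c : R) (hc : 0 < c) :
  exists k : nat, (0 < k)%N /\
    forall m : nat, (k <= m)%N ->
    forall f : 'rV[R]_m -> R, (forall x, 0 <= f x) ->
    exists S T' : {fset 'rV[R]_m},
      [/\ (k <= #|` S|)%N,
          T' `<=` S,
          #|` T'| = k,
          forall x y, x \in T' -> y \in S `\` T' -> f y <= f x &
          (linrank T')%:R < c * (max_linrank k S)%:R].
Proof.
have [n cn] : exists n, 1 < c * n.+1%:R.
  (* Truncating [1/c] and adding one gives an integer strictly above [1/c]. *)
  exists (Num.truncn c^-1).
  by rewrite mulrC -ltr_pdivrMr // div1r truncnS_gt.
exists n.+1; split=> // m km f _.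
pose e (i : 'I_n.+1) : 'rV[R]_m := delta_mx 0 (widen_ord km i).
(* The shift to [j.+1] avoids the zero vector, which would spoil the freeness of the kept
   vectors. *)
pose v (i j : 'I_n.+1) := j.+1%:R *: e i.
have vI i : injective (v i).
  move=> j j' /rowP/(_ (widen_ord km i)); rewrite !mxE !eqxx !mulr1 => /eqP.
  by rewrite eqr_nat eqSS => /eqP/val_inj.
pose w i := [arg min_(j < ord0) f (v i j)]%O.
have wP i j : f (v i (w i)) <= f (v i j).
  by rewrite /w; case: arg_minP => // j' _; apply.
pose L := [arg max_(i > ord0) f (v i (w i))]%O.
have LP i : f (v i (w i)) <= f (v L (w L)).
  by rewrite /L; case: arg_maxP => // i' _; apply.
pose s := [tuple v i (w i) | i < n.+1].
have sfree : free s.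
  apply: (free_scaled_basis (h := widen_ord km) (a := fun i => (w i).+1%:R)).
    by move=> i j /(congr1 val)/= /val_inj.
  by move=> i; rewrite pnatr_eq0.
pose T := [fset v L j | j in 'I_n.+1].
pose B : {fset 'rV[R]_m} := seq_fset tt s.
have Bs : B =i s by move=> x; rewrite seq_fsetE.
have Tk : #|` T| = n.+1 by rewrite card_imfset //= size_enum_ord.
have Bk : #|` B| = n.+1 by rewrite size_seq_fset undup_id ?free_uniq ?size_tuple.
(* Only line [L] enters in full; every other line contributes just its lowest vector. [T] and [B]
   share [v L (w L)]. *)
exists (T `|` B), T; split=> //.
- by rewrite -Tk fsubset_leq_card // fsubsetUl.
- exact: fsubsetUl.
- move=> _ y /imfsetP[j _ ->]; rewrite in_fsetD in_fsetU.
  (* Outside [T] only kept vectors remain, and [v L (w L)] separates the scores: it is at least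
     every kept score and at most every score on [L]. *)
  case/andP=> /negPf -> /=; rewrite Bs => /mapP[i _ ->].
  exact: le_trans (LP i) (wP L j).
have T1 : (linrank T <= 1)%N.
  apply: (@linrank_le1 _ _ (e L)) => _ /imfsetP[j _ ->].
  by rewrite memvZ ?memv_line.
(* The chain is [linrank T <= 1 < c * n.+1], where [n.+1] is the rank of [B], a competitor in the
   maximum. *)
apply: le_lt_trans (lt_le_trans cn _); first by rewrite lern1.
rewrite ler_pM2l // ler_nat -[leqLHS](size_tuple s) -(linrank_free Bs sfree).
by apply: linrank_le_max => //; apply: fsubsetUr.
Qed.
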